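(* Let $L_0$ be a locally finite weak semilattice and let $\mathscr R_0$ be a system of finite covers in $L_0$. Let $(L_0,\mathscr R_0),(L_1,\mathscr R_1),(L_2,\mathscr R_2),\dots$ be the sequence in which $(L_{i+1},\mathscr R_{i+1})$ is the locally finite weak semilattice of relative complements, with its system of finite covers, associated to $(L_i,\mathscr R_i)$. Let $d_{i+1}\colon\mathbb ZL_{i+1}\to\mathbb ZL_i$ be the algebra homomorphism induced by the inclusion $L_{i+1}\hookrightarrow\mathbb ZL_i$, and let $I_0=\operatorname{im}d_1$, the subalgebra of $\mathbb ZL_0$ generated by $\{\,l-\bigvee_{f\in F}f : l\in L_0,\ F\in\mathscr R_0(l)\}$ (which is an ideal). Then the sequence \[ \cdots \to \mathbb Z L_2 \xrightarrow{d_2} \mathbb Z L_1 \xrightarrow{d_1} \mathbb Z L_0 \to \mathbb Z L_0 / I_0 \to 0 \] is exact.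
   Context: A weak semilattice is a poset $L$ with least element $0$ such that for all $k,l\in L$ there is a finite set $A$ of common lower bounds of $k,l$ such that each common lower bound is $\le$ some element of $A$; $k\downarrow l$ is the finite set of maximal common lower bounds. It is locally finite if each finite subset lies in a finite subset closed under $\downarrow$. $L^\times=L\setminus\{0\}$. $k\perp l$ means that $0$ is the only common lower bound. A finite cover of $l\in L$ is a finite set $F\subseteq L$ of elements $\le l$ such that $k\perp f$ for all $f\in F$ implies $k\perp l$. For $k\le l$, $k\downarrow F$ is the set of maximal elements of $\bigcup_{f\in F}(k\downarrow f)$; for a set $\mathcal F$ of finite covers, $k\downarrow\mathcal F=\{k\downarrow F:F\in\mathcal F\}$. A system of finite covers in $L$ is a family $\mathscr R=(\mathscr R(l))_{l\in L}$, each $\mathscr R(l)$ a set of finite covers of $l$, such that $\{l\}\in\mathscr R(l)$ and $k\downarrow F\in\mathscr R(k)$ whenever $F\in\mathscr R(l)$ and $k\le l$. $\mathbb ZL$ is the free abelian group on $L^\times$ (with $0\in L$ identified with $0\in\mathbb ZL$), equipped with the commutative ring structure for which $l\mapsto1_{\{k\in L^\times:k\le l\}}$ induces an injective ring homomorphism to the functions $L^\times\to\mathbb Z$; so elements of $L$ are idempotents and $k\cdot l=\bigvee_{m\in k\downarrow l}m$, where $\bigvee_{p\in F}p=\sum_{\emptyset\ne F'\subseteq F}(-1)^{\#F'-1}\prod_{p\in F'}p$ for a finite set $F$ of commuting idempotents. For a finite set $\mathcal F$ of finite covers of $l$, $(l\mid\mathcal F)=l-\bigvee_{f\in F\in\mathcal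 F}f\in\mathbb ZL$. Given $(L_0,\mathscr R_0)$, the associated $L_1$ is $\{(l\mid\mathcal F):l\in L_0,\ \emptyset\ne\mathcal F\subseteq\mathscr R_0(l)\text{ finite}\}\cup\{0\}\subseteq\mathbb ZL_0$, ordered as idempotents ($p\le q$ iff $pq=p$); it is a locally finite weak semilattice. For $(l\mid\mathcal F)\in L_1$ and $F'\in\mathscr R_0(l)$, $R(l\mid\mathcal F\mid F')$ is the set of maximal elements of $\{(l\mid\mathcal F\cup\{F'\})\}\cup\{(f\mid f\downarrow\mathcal F):f\in F'\}$, and $\mathscr R_1(l\mid\mathcal F)=\{R(l\mid\mathcal F\mid F'):F'\in\mathscr R_0(l)\}$ (and $\mathscr R_1(0)=\{\{0\}\}$); it is a system of finite covers in $L_1$. $(L_{i+1},\mathscr R_{i+1})$ is obtained from $(L_i,\mathscr R_i)$ in the same way. *)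

(* Defs.v *)
From HB Require Import structures.
From mathcomp Require Import all_boot all_order all_algebra.
From mathcomp Require Import generic_quotient ring_quotient.
From mathcomp Require Import finmap.
From mathcomp Require Import boolp classical_sets cardinality.
From mathcomp Require Import freeg.

Set Implicit Arguments.
Unset Strict Implicit.
Unset Printing Implicit Defensive.

Import Order.Theory GRing.Theory Num.Theory.

Local Open Scope classical_set_scope.
Local Open Scope fset_scope.
Local Open Scope order_scope.

Definition common_lower d (L : porderType d) (k l : L) : set L :=
  [set m | m <= k /\ m <= l].

Definition maximal_elements d (L : porderType d) (A : set L) : set L :=
  [set m | A m /\ forall n, A n -> m <= n -> n = m].

Definition orthogonal d (L : bPOrderType d) (k l : L) : Prop :=
  forall m, common_lower k l m -> m = \bot.

(* [k ↓ l]; [fset_set] turns a finite set into an [fset] (and an infinite one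
   into [fset0]); in a weak semilattice the set is finite, see [meetsP]. *)
Definition meets d (L : porderType d) (k l : L) : {fset L} :=
  fset_set (maximal_elements (common_lower k l)).

Definition maxel d (L : porderType d) (A : {fset L}) : {fset L} :=
  [fset m in A | `[< maximal_elements [set` A] m >]].

HB.mixin Record isWeakSemilattice d L of Order.BPOrder d L := {
  common_lower_finite : forall k l : L, exists A : {fset L},
    (forall a, a \in A -> common_lower k l a) /\
    forall m, common_lower k l m -> exists2 a, a \in A & m <= a }.

#[short(type="weakSemilatticeType")]
HB.structure Definition WeakSemilattice d :=
  {L of Order.BPOrder d L & isWeakSemilattice d L}.

Definition meets_closed d (L : porderType d) (B : {fset L}) : Prop :=
  forall k l, k \in B -> l \in B -> meets k l `<=` B.

HB.mixin Record isLocallyFinite d L of WeakSemilattice d L := {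
  locally_finite : forall A : {fset L},
    exists B : {fset L}, A `<=` B /\ meets_closed B }.

#[short(type="lfWeakSemilatticeType")]
HB.structure Definition LFWeakSemilattice d :=
  {L of WeakSemilattice d L & isLocallyFinite d L}.

Definition finite_cover d (L : bPOrderType d) (l : L) (F : {fset L}) : Prop :=
  (forall f, f \in F -> f <= l) /\
  (forall k, (forall f, f \in F -> orthogonal k f) -> orthogonal k l).

(* [k ↓ F] and [k ↓ 𝓕] *)
Definition meetsF d (L : porderType d) (k : L) (F : {fset L}) : {fset L} :=
  maxel (\bigcup_(f <- F) meets k f).

Definition meetsFF d (L : porderType d) (k : L) (Fs : {fset {fset L}}) :
    {fset {fset L}} :=
  [fset meetsF k F | F in Fs].

Record cover_system d (L : bPOrderType d) := CoverSystem {
  covers :> L -> set {fset L};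
  covers_cover : forall l F, covers l F -> finite_cover l F;
  covers_self : forall l, covers l [fset l];
  covers_restrict : forall l k F, covers l F -> k <= l -> covers k (meetsF k F)
}.

Definition nz d (L : bPOrderType d) := {l : L | l != \bot}.
HB.instance Definition _ d (L : bPOrderType d) := Choice.on (nz L).

Definition ZL d (L : bPOrderType d) := {freeg (nz L)}.
HB.instance Definition _ d (L : bPOrderType d) := GRing.Lmodule.on (ZL L).

Section ZLdef.
Local Open Scope ring_scope.
Context d (L : bPOrderType d).
Implicit Types x y : ZL L.

Definition emb (l : L) : ZL L := if insub l is Some u then << u >> else 0.

(* The homomorphism to the functions [L^× -> Z] sending [l] to the indicator
   function of [{k | k <= l}]. *)
Definition ev x (k : nz L) : int :=
  fglift (fun l : nz L => ((val k <= val l)%O%:R : int^o)) x.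

(* The product that makes [ev] multiplicative; [ZL] has in general no unit.
   It is well defined by [ev_inj], and it exists by [ev_mul]. *)
Definition zmul x y : ZL L :=
  xget 0 [set z | forall k, ev z k = ev x k * ev y k].

(* The product of a nonempty list; the value on [::] is not used. *)
Definition zprod (s : seq (ZL L)) : ZL L :=
  if s is x :: s' then foldl zmul x s' else 0.

Definition zjoin (F : {fset ZL L}) : ZL L :=
  \sum_(G : {set F} | G != finset.set0)
    zprod [seq val p | p <- enum G] *~ (-1) ^+ #|G|.-1.

(* [(l | 𝓕)] *)
Definition relcompl (l : L) (Fs : {fset {fset L}}) : ZL L :=
  emb l - zjoin [fset emb f | f in (\bigcup_(F <- Fs) F)%fset].

End ZLdef.

Section Lemmas.
Context d (L : bPOrderType d).

Lemma maxelP (A : {fset L}) m :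
  m \in maxel A <-> m \in A /\ (forall n, n \in A -> m <= n -> n = m).
Proof.
rewrite !inE/=; split.
  by move=> /andP[mA /asboolP[_ h]]; split.
by move=> [mA h]; apply/andP; split => //; apply/asboolP; split.
Qed.

Lemma seq_extremal (T : eqType) (r : rel T) (s : seq T) x :
  reflexive r -> transitive r -> antisymmetric r -> x \in s ->
  exists2 y, y \in s & r x y /\ forall z, z \in s -> r y z -> z = y.
Proof.
move=> rr rt ra xs.
suff [y [ys xy ymax]] : exists y, [/\ (y == x) || (y \in s), r x y &
    forall z, z \in s -> r y z -> z = y].
  by exists y => //; case/predU1P: ys => [->|].
elim: s {xs} => [|a s [y [ys xy ymax]]].
  by exists x; rewrite eqxx rr.
have [ya|nya] := boolP (r y a).
  exists a; split; [by rewrite mem_head orbT | exact: rt ya|].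
  move=> z /predU1P[//|zs] az.
  have zy := ymax _ zs (rt _ _ _ ya az).
  by apply: ra; rewrite az {1}zy ya.
exists y; split=> //; first by rewrite inE orbCA ys orbT.
by move=> z /predU1P[->|/ymax//]; rewrite (negPf nya).
Qed.

Lemma maxel_above (A : {fset L}) x :
  x \in A -> exists2 y, y \in maxel A & x <= y.
Proof.
move=> xA; have [|||y yA [xy ymax]] :=
  @seq_extremal L (fun a b => a <= b) A x _ _ _ xA.
- exact: le_refl.
- exact: le_trans.
- exact: le_anti.
- by exists y => //; apply/maxelP.
Qed.

Lemma maxel_sub (A : {fset L}) x : x \in maxel A -> x \in A.
Proof. by case/maxelP. Qed.

Lemma maxel_ext (A B : {fset L}) :
  (forall x, x \in A -> exists2 y, y \in B & x <= y) ->
  (forall x, x \in B -> exists2 y, y \in A & x <= y) -> maxel A = maxel B.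
Proof.
have sub (C D : {fset L}) :
  (forall x, x \in C -> exists2 y, y \in D & x <= y) ->
  (forall x, x \in D -> exists2 y, y \in C & x <= y) ->
  forall m, m \in maxel C -> m \in maxel D.
  move=> CD DC m /maxelP[mC mmax]; apply/maxelP.
  have [y yD my] := CD _ mC; have [z zC yz] := DC _ yD.
  have zm := mmax _ zC (le_trans my yz).
  have ym : y = m by apply: le_anti; rewrite my -zm yz.
  split=> [|n nD mn]; first by rewrite -ym.
  have [w wC nw] := DC _ nD.
  have wm := mmax _ wC (le_trans mn nw).
  by apply: le_anti; rewrite mn andbT -wm.
by move=> AB BA; apply/fsetP => m; apply/idP/idP; apply: sub.
Qed.

End Lemmas.

Section WSL.
Context d (L : weakSemilatticeType d).

Lemma meetsP (k l m : L) :
  m \in meets k l <-> maximal_elements (common_lower k l) m.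
Proof.
rewrite /meets in_fset_set ?inE//.
have [A [Asub Adom]] := common_lower_finite k l.
apply: (@sub_finite_set _ _ [set` A]); last exact: finite_fset.
move=> x [xkl xmax] /=; have [a aA xa] := Adom _ xkl.
by rewrite -(xmax _ (Asub _ aA) xa).
Qed.

Lemma meets_lel (k l m : L) : m \in meets k l -> m <= k.
Proof. by move/meetsP => [[]]. Qed.

Lemma meets_ler (k l m : L) : m \in meets k l -> m <= l.
Proof. by move/meetsP => [[]]. Qed.

Lemma meets_sub (k l : L) (A : {fset L}) :
  (forall a, a \in A -> a <= k /\ a <= l) ->
  (forall m, m <= k -> m <= l -> exists2 a, a \in A & m <= a) ->
  meets k l `<=` A.
Proof.
move=> Asub Adom; apply/fsubsetP => m /meetsP[[mk ml] mmax].
by have [a aA ma] := Adom _ mk ml; rewrite -(mmax _ (Asub _ aA) ma).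
Qed.

Lemma meets_above (k l m : L) :
  m <= k -> m <= l -> exists2 n, n \in meets k l & m <= n.
Proof.
move=> mk ml; have [A [Asub Adom]] := common_lower_finite k l.
have [a aA ma] := Adom m (conj mk ml).
have [b /maxelP[bA bmax] ab] := maxel_above aA.
exists b; last exact: le_trans ma ab.
apply/meetsP; split=> [|n /[dup] nkl /Adom[c cA nc] bn]; first exact: Asub.
have cb := bmax _ cA (le_trans bn nc).
by apply: le_anti; rewrite bn andbT -cb.
Qed.

Lemma meetsF_le (k : L) F m :
  m \in meetsF k F -> m <= k /\ exists2 f, f \in F & m <= f.
Proof.
move/maxel_sub/bigfcupP => [f /andP[fF _] /[dup] /meets_lel mk /meets_ler mf].
by split=> //; exists f.
Qed.

Lemma meetsF_above (k : L) (F : {fset L}) f m :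
  f \in F -> m <= k -> m <= f -> exists2 n, n \in meetsF k F & m <= n.
Proof.
move=> fF mk mf; have [n nkf mn] := meets_above mk mf.
have /maxel_above[p pk np] : n \in (\bigcup_(f <- F) meets k f)%fset.
  by apply/bigfcupP; exists f => //; rewrite fF.
by exists p => //; apply: le_trans np.
Qed.

Lemma meetsFK (n k : L) F : n <= k -> meetsF n (meetsF k F) = meetsF n F.
Proof.
move=> nk; apply: maxel_ext => m /bigfcupP[f /andP[fF _] mnf].
- have [fk [g gF fg]] := meetsF_le fF.
  have mn := meets_lel mnf; have mf := meets_ler mnf.
  have [p pm mp] := meets_above mn (le_trans mf fg).
  by exists p => //; apply/bigfcupP; exists g => //; rewrite gF.
- have mn := meets_lel mnf; have mf := meets_ler mnf.
  have [p pF mp] := meetsF_above fF (le_trans mn nk) mf.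
  have [q qp mq] := meets_above mn mp.
  by exists q => //; apply/bigfcupP; exists p => //; rewrite pF.
Qed.

(* If [P] holds for some element of a finite [↓]-closed set [C] then there is a
   least such element. *)
Lemma closed_least (C : {fset L}) (P : L -> Prop) c :
  meets_closed C ->
  (forall a b, a \in C -> b \in C -> P a -> P b ->
     exists2 m, m \in meets a b & P m) ->
  c \in C -> P c ->
  exists c0, [/\ c0 \in C, P c0 & forall b, b \in C -> P b -> c0 <= b].
Proof.
move=> Ccl Pmeet cC Pc; pose s := [seq a <- C | `[< P a >]].
have cs : c \in s by rewrite mem_filter cC andbT; apply/asboolP.
have [|||c0] := @seq_extremal L (fun a b => b <= a) s c _ _ _ cs.
- exact: le_refl.
- by move=> x y z xy yz; apply: le_trans xy.
- by move=> x y; rewrite andbC; apply: le_anti.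
rewrite mem_filter => /andP[/asboolP Pc0 c0C] [_ c0min].
exists c0; split=> // b bC Pb; have [m mc0b Pm] := Pmeet _ _ c0C bC Pc0 Pb.
rewrite -(c0min m) ?(meets_ler mc0b) ?(meets_lel mc0b)//.
rewrite mem_filter; apply/andP; split; first exact/asboolP.
by have /fsubsetP := Ccl _ _ c0C bC; apply.
Qed.

End WSL.

Section Eval.
Local Open Scope ring_scope.
Context d (L : bPOrderType d).
Implicit Types (x y : ZL L) (k : nz L).

Let ev_at k x := ev x k.

Fact ev_additive k : zmod_morphism (ev_at k).
Proof.
move=> x y; exact: (@lift_is_additive int (nz L) int^o (fun l => ((val k <= val l)%O%:R : int^o)) x y).
Qed.

HB.instance Definition _ k :=
  GRing.isZmodMorphism.Build (ZL L) int (ev_at k) (ev_additive k).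

Lemma ev0 k : ev (0 : ZL L) k = 0.
Proof. exact: (raddf0 (ev_at k)). Qed.

Lemma evD x y k : ev (x + y) k = ev x k + ev y k.
Proof. exact: (raddfD (ev_at k)). Qed.

Lemma evB x y k : ev (x - y) k = ev x k - ev y k.
Proof. exact: (raddfB (ev_at k)). Qed.

Lemma evMz x n k : ev (x *~ n) k = ev x k *~ n.
Proof. exact: (raddfMz (ev_at k)). Qed.

Lemma ev_sum I (r : seq I) (P : pred I) (F : I -> ZL L) k :
  ev (\sum_(i <- r | P i) F i) k = \sum_(i <- r | P i) ev (F i) k.
Proof. exact: (raddf_sum (ev_at k)). Qed.

Lemma evU (c : int) l k :
  ev (<< c *g l >> : ZL L) k = c * (val k <= val l)%O%:R.
Proof. by rewrite /ev liftU. Qed.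

Lemma evE x k :
  ev x k = \sum_(l <- dom x) coeff l x * (val k <= val l)%O%:R.
Proof.
by rewrite -[in LHS](freeg_sumE x) ev_sum; apply: eq_bigr => l _; rewrite evU.
Qed.

Lemma ev_inj x y : ev x =1 ev y -> x = y.
Proof.
suff H : forall z, ev z =1 (fun=> 0) -> z = 0 :> ZL L.
  move=> xy; apply/eqP; rewrite -subr_eq0; apply/eqP; apply: H => k.
  by rewrite evB xy subrr.
move=> z z0; apply/eqP; rewrite -dom_eq0; case E: (dom z) => [//|l s].
have lz : l \in dom z by rewrite E mem_head.
have [|||m mz [_ mmax]] :=
  @seq_extremal _ (fun a b : nz L => (val a <= val b)%O) (dom z) l _ _ _ lz.
- by move=> a; apply: le_refl.
- by move=> a b c; apply: le_trans.
- by move=> a b /le_anti/val_inj.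
have := z0 m; rewrite evE (bigD1_seq m)//= ?uniq_dom// lexx mulr1.
rewrite big_seq_cond big1 ?addr0; last first.
  move=> w /andP[wz wm]; case: (boolP (val m <= val w)%O); last by rewrite mulr0.
  by move/(mmax _ wz) => /eqP; rewrite (negPf wm).
by move/eqP; rewrite mem_dom in mz; rewrite (negPf mz).
Qed.

Lemma ev_emb (l : L) k : ev (emb l) k = (val k <= l)%O%:R.
Proof.
rewrite /emb; case: insubP => [u _ <-|]; first by rewrite evU mul1r.
rewrite negbK => /eqP ->; rewrite ev0 lex0.
by rewrite (negPf (valP k)).
Qed.

End Eval.

Section Ring.
Local Open Scope ring_scope.
Context d (L : lfWeakSemilatticeType d).
Implicit Types (x y z : ZL L) (k : nz L).

Definition realized (f : nz L -> int) := exists z, ev z =1 f.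

Lemma realized_sum I (r : seq I) (P : pred I) (f : I -> nz L -> int) :
  (forall i, realized (f i)) ->
  realized (fun k => \sum_(i <- r | P i) f i k).
Proof.
move=> h; have [z zE] := choice h; exists (\sum_(i <- r | P i) z i) => k.
by rewrite ev_sum; apply: eq_bigr => i _; exact: zE.
Qed.

Lemma realizedM (c : int) (f : nz L -> int) :
  realized f -> realized (fun k => c * f k).
Proof.
by move=> [z zE]; exists (z *~ c) => k; rewrite evMz zE -mulrzr mulrC intz.
Qed.

Definition least_above (C : {fset L}) (c : L) k : bool :=
  [&& c \in C, (val k <= c)%O & all (fun b => (val k <= b) ==> (c <= b))%O C].

Lemma least_aboveP (C : {fset L}) c k : meets_closed C -> c \in C ->
  (val k <= c)%O -> exists c0, least_above C c0 k.
Proof.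
move=> Ccl cC kc.
have [|c0 [c0C kc0 c0min]] :=
  @closed_least _ L C (fun a => val k <= a)%O c Ccl _ cC kc.
  by move=> a b _ _; apply: meets_above.
exists c0; rewrite /least_above c0C kc0; apply/allP => b bC.
by apply/implyP; apply: c0min.
Qed.

Lemma least_above_uniq (C : {fset L}) c c' k :
  least_above C c k -> least_above C c' k -> c = c'.
Proof.
move=> /and3P[cC kc /allP h] /and3P[c'C kc' /allP h'].
by apply: le_anti; rewrite (implyP (h _ c'C))// (implyP (h' _ cC)).
Qed.

Lemma sum_least_above (C : {fset L}) (P : pred L) c0 k :
  least_above C c0 k ->
  \sum_(c <- C | P c) (least_above C c k)%:R = (P c0)%:R :> int.
Proof.
move=> h; have c0C : c0 \in C by case/and3P: h.
rewrite big_mkcond (bigD1_seq c0)//= ?fset_uniq// h big1 ?addr0.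
  by case: (P c0).
move=> c cc0; case: (boolP (least_above C c k)) => [hc|_].
  by rewrite (least_above_uniq hc h) eqxx in cc0.
by case: (P c).
Qed.

Lemma sum_least_above0 (C : {fset L}) (P : pred L) k :
  (forall c, ~~ least_above C c k) ->
  \sum_(c <- C | P c) (least_above C c k)%:R = 0 :> int.
Proof. by move=> h; apply: big1 => c _; rewrite (negPf (h c)). Qed.

Lemma realized0 : realized (fun=> 0).
Proof. by exists 0 => k; rewrite ev0. Qed.

Lemma realized_least_above (C : {fset L}) c :
  meets_closed C -> realized (fun k => (least_above C c k)%:R).
Proof.
move=> Ccl; pose good c := realized (fun k => (least_above C c k)%:R).
apply: contrapT => badc.
have cC : c \in C.
  apply: contra_notT badc => cC; have [z zE] := realized0; exists z => k.
  by rewrite zE /least_above (negPf cC).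
have : c \in [seq b <- C | `[< ~ good b >]].
  by rewrite mem_filter cC andbT; apply/asboolP.
move/(@seq_extremal _ (fun a b : L => b <= a)%O) => [|||b].
- exact: le_refl.
- by move=> x y z xy yz; apply: le_trans xy.
- by move=> x y; rewrite andbC; apply: le_anti.
rewrite mem_filter => /andP[/asboolP badb bC] [_ bmin]; apply: badb.
have [z zE] : realized (fun k =>
    \sum_(a <- C | (a < b)%O) (least_above C a k)%:R).
  have [a|z zE] := @realized_sum _ C xpredT
    (fun a => if (a \in C) && (a < b)%O then
       fun k => (least_above C a k)%:R else fun=> 0).
    case: ifP => [/andP[aC ab]|_]; last exact: realized0.
    apply: contrapT => bada.
    have /bmin ba : a \in [seq b <- C | `[< ~ good b >]].
      by rewrite mem_filter aC andbT; apply/asboolP.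
    by have := ab; rewrite (ba (ltW ab)) ltxx.
  exists z => k; rewrite zE [RHS]big_mkcond/= !big_seq.
  by apply: eq_bigr => a -> /=; case: ifP.
exists (emb b - z) => k; rewrite evB ev_emb zE.
have [kb|nkb] := boolP (val k <= b)%O; last first.
  rewrite big1 ?subr0; last first.
    move=> a ab; rewrite /least_above; case: (boolP (_ <= a)%O); rewrite ?andbF//.
    by move=> ka; rewrite (le_trans ka (ltW ab)) in nkb.
  by rewrite /least_above (negPf nkb) andbF.
have [c0 hc0] := least_aboveP Ccl bC kb.
rewrite (@sum_least_above C (fun a => a < b)%O c0)//.
have [c0b|c0b] := eqVneq c0 b; first by rewrite c0b ltxx subr0 -c0b hc0.
have -> : (c0 < b)%O.
  rewrite lt_neqAle c0b; case/and3P: hc0 => _ _ /allP/(_ _ bC)/implyP; exact.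
rewrite subrr; case: (boolP (least_above C b k)) => // hb.
by rewrite (least_above_uniq hc0 hb) eqxx in c0b.
Qed.

Lemma realized_mulU (a b : nz L) :
  realized (fun k => (val k <= val a)%O%:R * (val k <= val b)%O%:R).
Proof.
have [C [/fsubsetP AC Ccl]] := locally_finite [fset val a; val b]%fset.
have aC : val a \in C by apply: AC; rewrite !inE eqxx.
have bC : val b \in C by apply: AC; rewrite !inE eqxx orbT.
pose P c := ((c <= val a) && (c <= val b))%O.
have [c|z zE] := @realized_sum _ C P (fun c k => (least_above C c k)%:R).
  exact: realized_least_above.
exists z => k; rewrite zE.
have [[c0 hc0]|h] := pselect (exists c, least_above C c k); last first.
  rewrite sum_least_above0; last by move=> c; apply/negP => hc; apply: h; exists c.
  have [ka|] := boolP (val k <= val a)%O; last by rewrite mul0r.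
  by have [c hc] := least_aboveP Ccl aC ka; case: h; exists c.
rewrite (sum_least_above _ hc0) /P.
case/and3P: hc0 => _ kc0 /allP c0min.
have E (e : nz L) : val e \in C -> (c0 <= val e)%O = (val k <= val e)%O.
  move=> eC; apply/idP/idP; first exact: le_trans.
  exact/implyP/c0min.
by rewrite !E// -natrM mulnb.
Qed.

Lemma ev_mul x y k : ev (zmul x y) k = ev x k * ev y k.
Proof.
suff : exists z, [set z | forall k, ev z k = ev x k * ev y k] z.
  by move/(xgetPex 0) => /=; apply.
have [a|z zE] := @realized_sum _ (dom x) xpredT (fun a k =>
  \sum_(b <- dom y) (coeff a x * coeff b y) *
     ((val k <= val a)%O%:R * (val k <= val b)%O%:R)).
  apply: realized_sum => b; apply: realizedM; exact: realized_mulU.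
exists z => {}k /=; rewrite zE !evE mulr_suml; apply: eq_bigr => a _.
by rewrite mulr_sumr; apply: eq_bigr => b _; rewrite mulrACA.
Qed.

Lemma zmulC : commutative (@zmul _ L).
Proof. by move=> x y; apply: ev_inj => k; rewrite !ev_mul mulrC. Qed.

Lemma zmulA : associative (@zmul _ L).
Proof. by move=> x y z; apply: ev_inj => k; rewrite !ev_mul mulrA. Qed.

Lemma zmulDl : left_distributive (@zmul _ L) +%R.
Proof. by move=> x y z; apply: ev_inj => k; rewrite !(ev_mul, evD) mulrDl. Qed.

Lemma zmul_emb (l : L) : zmul (emb l) (emb l) = emb l.
Proof.
by apply: ev_inj => k; rewrite ev_mul ev_emb -natrM mulnb andbb.
Qed.

Lemma ev_zprod (s : seq (ZL L)) k :
  s != [::] -> ev (zprod s) k = \prod_(x <- s) ev x k.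
Proof.
case: s => // x s _; rewrite big_cons /=.
elim: s x => [|y s IH] x /=; first by rewrite big_nil mulr1.
by rewrite IH ev_mul big_cons mulrA.
Qed.

Lemma ev_zjoin (F : {fset ZL L}) k :
  ev (zjoin F) k = 1 - \prod_(p : F) (1 - ev (val p) k).
Proof.
rewrite /zjoin ev_sum.
under [X in _ = 1 - X]eq_bigr => p _ do rewrite addrC.
have -> : \prod_(p : F) (- ev (val p) k + 1) =
    \sum_(J : {set F}) \prod_(p : F) (if p \in J then - ev (val p) k else 1).
  by rewrite bigA_distr; apply: eq_bigl.
rewrite [X in _ = 1 - X](bigD1 finset.set0)//= [X in 1 - (X + _)]big1; last first.
  by move=> p _; rewrite finset.in_set0.
rewrite opprD addrA subrr add0r -sumrN; apply: eq_bigr => G G0.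
rewrite evMz ev_zprod; last first.
  by rewrite -size_eq0 size_map -cardE cards_eq0.
rewrite big_map big_enum/= -big_mkcond/= prodrN -mulrzr intz.
rewrite -[in RHS](prednK (n := #|G|)) ?card_gt0// exprS mulN1r mulNr opprK.
by rewrite mulrC.
Qed.

Lemma ev_zjoin_emb (F : {fset L}) k :
  ev (zjoin [fset emb f | f in F]%fset) k =
  (has (fun f => (val k <= f)%O) F)%:R.
Proof.
rewrite ev_zjoin; case: hasP => [[f fF kf]|nF].
  have fE : emb f \in [fset emb f | f in F]%fset by apply/imfsetP; exists f.
  by rewrite (bigD1 [` fE]%fset)//= ev_emb kf subrr mul0r subr0.
rewrite big1 ?subrr// => -[p /=] /imfsetP[f fF ->] _.
rewrite ev_emb; case: (boolP (val k <= f)%O) => [kf|]; last by rewrite subr0.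
by case: nF; exists f.
Qed.

Lemma zmul_embE (l m : L) :
  zmul (emb l) (emb m) = zjoin [fset emb n | n in meets l m]%fset.
Proof.
apply: ev_inj => k; rewrite ev_mul ev_zjoin_emb !ev_emb -natrM mulnb.
congr (nat_of_bool _)%:R; apply/andP/hasP => [[kl km]|[n nlm kn]].
  by have [n ? ?] := meets_above kl km; exists n.
by rewrite !(le_trans kn) ?(meets_lel nlm) ?(meets_ler nlm).
Qed.

Definition below (l : L) (Fs : {fset {fset L}}) : bool :=
  has (fun F : {fset L} => has (fun f => l <= f)%O F) Fs.

Lemma belowP (l : L) (Fs : {fset {fset L}}) :
  reflect (exists F f, [/\ F \in Fs, f \in F & (l <= f)%O]) (below l Fs).
Proof.
apply: (iffP hasP) => [[F FF /hasP[f fF lf]]|[F [f [FF fF lf]]]].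
  by exists F, f.
by exists F => //; apply/hasP; exists f.
Qed.

Lemma ev_relcompl (l : L) (Fs : {fset {fset L}}) k :
  (forall F f, F \in Fs -> f \in F -> (f <= l)%O) ->
  ev (relcompl l Fs) k = ((val k <= l)%O && ~~ below (val k) Fs)%:R.
Proof.
move=> Fsl; rewrite /relcompl evB ev_emb ev_zjoin_emb.
have -> : has (fun f => (val k <= f)%O) (\bigcup_(F <- Fs) F)%fset =
    below (val k) Fs.
  apply/hasP/belowP => [[f /bigfcupP[F /andP[FF _] fF] kf]|[F [f [FF fF kf]]]].
    by exists F, f.
  by exists f => //; apply/bigfcupP; exists F => //; rewrite FF.
case: belowP => [[F [f [FF fF kf]]]|_]; last by rewrite subr0 andbT.
by rewrite (le_trans kf (Fsl _ _ FF fF)) subrr.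
Qed.

End Ring.

Section RelativeComplements.
Local Open Scope ring_scope.
Context d (L : lfWeakSemilatticeType d) (R : cover_system L).
Implicit Types (k l : L) (F : {fset L}) (Fs : {fset {fset L}}).

Definition cover_set l Fs : Prop :=
  Fs != fset0 /\ forall F, F \in Fs -> R l F.

Definition is_relcompl (x : ZL L) : Prop :=
  x = 0 \/ exists l Fs, cover_set l Fs /\ x = relcompl l Fs.

Definition RC := {x : ZL L | `[< is_relcompl x >]}.
HB.instance Definition _ := Choice.on RC.

Definition rc_le (p q : RC) : bool := zmul (val p) (val q) == val p.

Definition rc_supp (p : RC) (k : nz L) : bool := ev (val p) k != 0.

Lemma cover_set_le l Fs : cover_set l Fs ->
  forall F f, F \in Fs -> f \in F -> (f <= l)%O.
Proof. by move=> [_ H] F f /H/covers_cover[h _] /h. Qed.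

Lemma ev_rc (p : RC) (k : nz L) : ev (val p) k = (rc_supp p k)%:R.
Proof.
rewrite /rc_supp; case: p => x /= /asboolP[->|[l [Fs [/cover_set_le H ->]]]].
  by rewrite ev0 eqxx.
by rewrite ev_relcompl//; case: (_ && _).
Qed.

Lemma rc_leE (p q : RC) :
  rc_le p q <-> forall k : nz L, rc_supp p k -> rc_supp q k.
Proof.
split=> [/eqP pq k|pq].
  by have := ev_rc p k; rewrite -pq ev_mul !ev_rc; do 2 case: rc_supp.
apply/eqP/ev_inj => k; rewrite ev_mul !ev_rc; have := pq k.
by case: (rc_supp p k) => [/(_ isT) ->|_]; rewrite ?mulr1 ?mul0r.
Qed.

Lemma rc_suppI (p q : RC) : rc_supp p =1 rc_supp q -> p = q.
Proof.
by move=> pq; apply/val_inj/ev_inj => k; rewrite !ev_rc pq.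
Qed.

Fact rc_le_refl : reflexive rc_le.
Proof. by move=> p; apply/rc_leE. Qed.

Fact rc_le_anti : antisymmetric rc_le.
Proof.
move=> p q /andP[/rc_leE pq /rc_leE qp]; apply: rc_suppI => k.
by apply/idP/idP => [/pq|/qp].
Qed.

Fact rc_le_trans : transitive rc_le.
Proof.
by move=> q p r /rc_leE pq /rc_leE qr; apply/rc_leE => k /pq /qr.
Qed.

HB.instance Definition _ :=
  Order.Le_isPOrder.Build d RC rc_le_refl rc_le_anti rc_le_trans.

Fact is_relcompl0 : `[< is_relcompl 0 >]. Proof. by apply/asboolP; left. Qed.

Definition rc0 : RC := exist _ 0 is_relcompl0.

Fact rc_le0x (p : RC) : (rc0 <= p)%O.
Proof. by apply/rc_leE => k; rewrite /rc_supp/= ev0 eqxx. Qed.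

HB.instance Definition _ := Order.hasBottom.Build d RC rc_le0x.

Lemma rcleP (p q : RC) :
  (p <= q)%O <-> (forall k : nz L, rc_supp p k -> rc_supp q k).
Proof. exact: rc_leE. Qed.

Lemma rc_supp0 (k : nz L) : rc_supp \bot%O k = false.
Proof. by rewrite /rc_supp/= ev0 eqxx. Qed.

(* [(l | 𝓕)] as an element of [RC], for [cover_set l 𝓕] *)
Definition rc l Fs : RC := insubd rc0 (relcompl l Fs).

Lemma val_rc l Fs : cover_set l Fs -> val (rc l Fs) = relcompl l Fs.
Proof.
by move=> h; rewrite val_insubd asboolT//; right; exists l, Fs.
Qed.

Lemma rc_supp_rc l Fs (k : nz L) : cover_set l Fs ->
  rc_supp (rc l Fs) k = (val k <= l)%O && ~~ below (val k) Fs.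
Proof.
move=> h; rewrite /rc_supp val_rc// ev_relcompl; last exact: cover_set_le.
by case: (_ && _).
Qed.

Lemma rcP (p : RC) :
  p = \bot%O \/ exists l Fs, [/\ cover_set l Fs, p = rc l Fs & l != \bot%O].
Proof.
have := valP p; rewrite /= => /asboolP[x0|[l [Fs [h xE]]]]; first by left; apply: val_inj.
have pE : p = rc l Fs by apply: val_inj; rewrite val_rc.
have [l0|l0] := eqVneq l \bot%O; last by right; exists l, Fs.
left; apply: rc_suppI => k; rewrite rc_supp0 pE rc_supp_rc// l0 lex0.
by rewrite (negPf (valP k)).
Qed.

Lemma below_meets n k Fs : (k <= n)%O -> below k (meetsFF n Fs) = below k Fs.
Proof.
move=> kn; apply/belowP/belowP => [[_ [f [/imfsetP[F /= FF ->] fF kf]]]|].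
  have [_ [g gF fg]] := meetsF_le fF.
  by exists F, g; split => //; apply: le_trans fg.
move=> [F [f [FF fF kf]]]; have [g gF kg] := meetsF_above fF kn kf.
by exists (meetsF n F), g; split=> //; apply/imfsetP; exists F.
Qed.

Lemma belowU k Fs Gs : below k (Fs `|` Gs)%fset = below k Fs || below k Gs.
Proof.
apply/belowP/orP => [[F [f [/fsetUP[FF|FF] fF kf]]]|].
- by left; apply/belowP; exists F, f.
- by right; apply/belowP; exists F, f.
by move=> [/belowP[F [f [FF fF kf]]]|/belowP[F [f [FF fF kf]]]]; exists F, f;
  rewrite inE FF ?orbT.
Qed.

Lemma below1 k F : below k [fset F]%fset = has (fun f => k <= f)%O F.
Proof.
apply/belowP/hasP => [[G [f [/fset1P -> fF kf]]]|[f fF kf]]; first by exists f.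
by exists F, f; rewrite inE.
Qed.

Lemma cover_set_meets l k Fs :
  (k <= l)%O -> cover_set l Fs -> cover_set k (meetsFF k Fs).
Proof.
move=> kl [/fset0Pn[F FF] Fsl]; split.
  by apply/fset0Pn; exists (meetsF k F); apply/imfsetP; exists F.
by move=> _ /imfsetP[G /= GF ->]; apply: covers_restrict kl; apply: Fsl.
Qed.

Lemma cover_setU l Fs Gs :
  cover_set l Fs -> cover_set l Gs -> cover_set l (Fs `|` Gs)%fset.
Proof.
move=> [/fset0Pn[F FF] Fsl] [_ Gsl]; split.
  by apply/fset0Pn; exists F; rewrite inE FF.
by move=> G /fsetUP[/Fsl|/Gsl].
Qed.

Lemma cover_setU1 l F Fs :
  cover_set l Fs -> R l F -> cover_set l (F |` Fs)%fset.
Proof.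
move=> [_ Fsl] lF; split; first by apply/fset0Pn; exists F; rewrite !inE eqxx.
by move=> G /fset1UP[->|/Fsl].
Qed.

(* A nonzero [(k | 𝓖)] has [k] in its support. *)
Lemma rc_top p : p != \bot%O :> RC -> exists (k : nz L) Gs,
  [/\ cover_set (val k) Gs, p = rc (val k) Gs, rc_supp p k &
       forall j : nz L, rc_supp p j -> (val j <= val k)%O].
Proof.
case: (rcP p) => [->|[l [Fs [h pE l0]]] p0]; first by rewrite eqxx.
exists (Sub l l0 : nz L), Fs; split=> //.
  rewrite pE rc_supp_rc//= lexx/=; apply: contra p0 => /belowP[F [f [FF fF lf]]].
  apply/eqP/rc_suppI => k; rewrite rc_supp0 pE rc_supp_rc//.
  apply/andP => -[kl /belowP]; apply; exists F, f; split=> //.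
  exact: le_trans lf.
by move=> j; rewrite pE rc_supp_rc// => /andP[].
Qed.

Definition rc_meets (k l : L) Fs Gs : {fset RC} :=
  [fset rc n (meetsFF n Fs `|` meetsFF n Gs) | n in meets k l]%fset.

Lemma rc_meetsP k l Fs Gs : cover_set k Fs -> cover_set l Gs ->
  (forall a, a \in rc_meets k l Fs Gs -> a <= rc k Fs /\ a <= rc l Gs)%O /\
  (forall m, m <= rc k Fs -> m <= rc l Gs ->
     exists2 a, a \in rc_meets k l Fs Gs & m <= a)%O.
Proof.
move=> hk hl.
have hn n : n \in meets k l -> cover_set n (meetsFF n Fs `|` meetsFF n Gs)%fset.
  move=> nkl; apply: cover_setU.
    exact: cover_set_meets (meets_lel nkl) hk.
  exact: cover_set_meets (meets_ler nkl) hl.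
split=> [_ /imfsetP[n /= nkl ->]|m mk ml].
  split; apply/rcleP => j; rewrite !rc_supp_rc//; try exact: hn.
    rewrite belowU negb_or => /and3P[jn + _]; rewrite below_meets// => ->.
    by rewrite (le_trans jn (meets_lel nkl)).
  rewrite belowU negb_or => /and3P[jn _]; rewrite below_meets// => ->.
  by rewrite (le_trans jn (meets_ler nkl)).
have [->|m0] := eqVneq m \bot%O.
  have [n nkl _] := meets_above (le0x k) (le0x l).
  exists (rc n (meetsFF n Fs `|` meetsFF n Gs)%fset); last exact: le0x.
  by apply/imfsetP; exists n.
have [i [Hs [_ _ mi mtop]]] := rc_top m0.
have ik : (val i <= k)%O.
  by have /rcleP/(_ _ mi) := mk; rewrite rc_supp_rc// => /andP[].
have il : (val i <= l)%O.
  by have /rcleP/(_ _ mi) := ml; rewrite rc_supp_rc// => /andP[].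
have [n nkl ni] := meets_above ik il.
exists (rc n (meetsFF n Fs `|` meetsFF n Gs)%fset).
  by apply/imfsetP; exists n.
apply/rcleP => j mj; rewrite rc_supp_rc; last exact: hn.
have jn : (val j <= n)%O by apply: le_trans ni; apply: mtop.
rewrite jn belowU negb_or !below_meets//.
have /rcleP/(_ _ mj) := mk; rewrite rc_supp_rc// => /andP[_ ->].
by have /rcleP/(_ _ mj) := ml; rewrite rc_supp_rc// => /andP[_ ->].
Qed.

Lemma rc_supp_common p q (i : nz L) : rc_supp p i -> rc_supp q i ->
  exists m : RC, [/\ m <= p, m <= q & rc_supp m i]%O.
Proof.
have [->|[k [Fs [hk -> _]]]] := rcP p; first by rewrite rc_supp0.
have [->|[l [Gs [hl -> _]]]] := rcP q; first by rewrite rc_supp0.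
have [h1 _] := rc_meetsP hk hl.
rewrite !rc_supp_rc// => /andP[ik iFs] /andP[il iGs].
have [n nkl ni] := meets_above ik il.
exists (rc n (meetsFF n Fs `|` meetsFF n Gs)%fset).
have [] := h1 (rc n (meetsFF n Fs `|` meetsFF n Gs)%fset).
  by apply/imfsetP; exists n.
split=> //; rewrite rc_supp_rc.
  by rewrite ni belowU negb_or !below_meets// iFs.
by apply: cover_setU; [apply: cover_set_meets hk; exact: meets_lel nkl|
  apply: cover_set_meets hl; exact: meets_ler nkl].
Qed.

Fact rc_common_lower_finite (p q : RC) : exists A : {fset RC},
  (forall a, a \in A -> common_lower p q a) /\
  forall m, common_lower p q m -> exists2 a, a \in A & (m <= a)%O.
Proof.
have [->|[k [Fs [hk -> _]]]] := rcP p.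
  exists [fset \bot%O]%fset; split=> [a /fset1P ->|m [m0 _]].
    by split; apply: le0x.
  by exists \bot%O; rewrite ?inE.
have [->|[l [Gs [hl -> _]]]] := rcP q.
  exists [fset \bot%O]%fset; split=> [a /fset1P ->|m [_ m0]].
    by split; apply: le0x.
  by exists \bot%O; rewrite ?inE.
have [h1 h2] := rc_meetsP hk hl.
by exists (rc_meets k l Fs Gs); split=> [a /h1//|m []]; apply: h2.
Qed.

HB.instance Definition _ :=
  isWeakSemilattice.Build d RC rc_common_lower_finite.

Fact rc_locally_finite (A : {fset RC}) :
  exists B : {fset RC}, (A `<=` B)%fset /\ meets_closed B.
Proof.
have /choice[r rP] (p : RC) : exists lF : L * {fset {fset L}},
    p = \bot%O \/ cover_set lF.1 lF.2 /\ p = rc lF.1 lF.2.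
  have [->|[l [Fs [h pE _]]]] := rcP p; first by exists (\bot%O, fset0); left.
  by exists (l, Fs); right.
have [C [/fsubsetP AC Ccl]] := locally_finite [fset (r p).1 | p in A]%fset.
pose U := (\bigcup_(p <- A) (r p).2)%fset.
pose B := (\bot%O |` [fset rc c (meetsFF c Fs) |
  c in C, Fs in [fset Fs in fpowerset U | `[< cover_set c (meetsFF c Fs) >]]])%fset.
have BP p : p \in B -> p = \bot%O \/ exists c Fs,
    [/\ c \in C, Fs `<=` U, cover_set c (meetsFF c Fs) & p = rc c (meetsFF c Fs)]%fset.
  move=> /fset1UP[|/imfset2P[c /= cC [Fs]]]; first by left.
  rewrite !inE /= fpowersetE => /andP[FU /asboolP h] ->; right.
  by exists c, Fs.
have BI c Fs : c \in C -> (Fs `<=` U)%fset -> cover_set c (meetsFF c Fs) ->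
    rc c (meetsFF c Fs) \in B.
  move=> cC FU h; apply/fset1UP; right; apply/imfset2P; exists c => //=.
  by exists Fs => //; rewrite !inE/= fpowersetE FU; apply/asboolP.
have B0 : \bot%O \in B by exact: fset1U1.
clearbody B; exists B; split.
  apply/fsubsetP => p pA; have [->|[h pE]] := rP p; first exact: B0.
  have -> : p = rc (r p).1 (meetsFF (r p).1 (r p).2).
    rewrite [LHS]pE; apply: rc_suppI => k.
    rewrite !rc_supp_rc//; last exact: cover_set_meets h.
    by case: (boolP (_ <= _)%O) => //= kr; rewrite below_meets.
  apply: BI; last exact: cover_set_meets h.
    by apply: AC; apply/imfsetP; exists p.
  by apply/fsubsetP => F Fp; apply/bigfcupP; exists p; rewrite ?pA.
move=> p q /BP + /BP.
have meets0 (a b : RC) : a = \bot%O \/ b = \bot%O -> (meets a b `<=` B)%fset.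
  move=> ab; apply/fsubsetP => m mab.
  suff -> : m = \bot%O by exact: B0.
  apply/eqP; rewrite -lex0.
  by case: ab => <-; [exact: meets_lel mab|exact: meets_ler mab].
move=> [->|[c [Fs [cC FU hc ->]]]]; first by move=> _; apply: meets0; left.
move=> [->|[e [Gs [eC GU he ->]]]]; first by apply: meets0; right.
have [h1 h2] := rc_meetsP hc he.
apply: fsubset_trans (meets_sub h1 h2) _.
apply/fsubsetP => _ /imfsetP[n /= nce ->].
have nc := meets_lel nce; have ne := meets_ler nce.
have E k Hs : (n <= k)%O -> meetsFF n (meetsFF k Hs) = meetsFF n Hs.
  move=> nk; apply/fsetP => F; apply/imfsetP/imfsetP.
    by move=> [_ /imfsetP[G /= GH ->] ->]; exists G; rewrite ?meetsFK.
  move=> [G /= GH ->]; exists (meetsF k G); rewrite ?meetsFK//.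
  by apply/imfsetP; exists G.
have EU : (meetsFF n Fs `|` meetsFF n Gs)%fset = meetsFF n (Fs `|` Gs)%fset.
  by rewrite /meetsFF imfsetU.
have := cover_setU (cover_set_meets nc hc) (cover_set_meets ne he).
rewrite !E// EU; apply: BI; last by rewrite fsubUset FU.
by have /fsubsetP := Ccl _ _ cC eC; apply.
Qed.

HB.instance Definition _ := isLocallyFinite.Build d RC rc_locally_finite.

(* [R(l | 𝓕 | F')] *)
Definition rc_cover l Fs F' : {fset RC} :=
  maxel (rc l (F' |` Fs) |` [fset rc f (meetsFF f Fs) | f in F'])%fset.

Definition rc_covers (p : RC) : set {fset RC} := [set G |
  (exists l Fs F', [/\ cover_set l Fs, R l F', p = rc l Fs &
                        G = rc_cover l Fs F']) \/
  (p = \bot%O /\ G = [fset \bot%O]%fset)].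

Lemma rc_coverP l Fs F' s : cover_set l Fs -> R l F' ->
  s \in (rc l (F' |` Fs) |` [fset rc f (meetsFF f Fs) | f in F'])%fset ->
  (s <= rc l Fs)%O.
Proof.
move=> h lF /fset1UP[->|/imfsetP[f /= fF ->]]; apply/rcleP => k.
  rewrite !rc_supp_rc//; last exact: cover_setU1.
  by rewrite belowU negb_or => /and3P[-> _].
have fl : (f <= l)%O by apply: (covers_cover lF).1.
rewrite !rc_supp_rc//; last exact: cover_set_meets h.
by move=> /andP[kf]; rewrite below_meets// (le_trans kf fl).
Qed.

Fact rc_covers_cover p G : rc_covers p G -> finite_cover p G.
Proof.
move=> [[l [Fs [F' [h lF -> ->]]]]|[-> ->]]; last first.
  by split=> [f /fset1P ->//|k hk]; apply: hk; exact: fset11.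
split=> [g /maxel_sub|q qG]; first exact: rc_coverP.
move=> m [mq ml]; apply/eqP; apply: contraT => m0.
have [i [Hs [_ _ mi mtop]]] := rc_top m0.
have := ml; move=> /rcleP/(_ _ mi); rewrite rc_supp_rc// => /andP[il iFs].
suff [s sS si] : exists2 s, s \in (rc l (F' |` Fs) |`
    [fset rc f (meetsFF f Fs) | f in F'])%fset & rc_supp s i.
  have [g gG sg] := maxel_above sS.
  have gi : rc_supp g i by move/rcleP : sg; apply.
  have [r [rm rg ri]] := rc_supp_common mi gi.
  have r0 := qG _ gG r (conj (le_trans rm mq) rg).
  by rewrite r0 rc_supp0 in ri.
have [/hasP[f fF jf]|nF] := boolP (has (fun f => val i <= f)%O F').
  exists (rc f (meetsFF f Fs)).
    by apply/fset1UP; right; apply/imfsetP; exists f.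
  have fl : (f <= l)%O by apply: (covers_cover lF).1.
  rewrite rc_supp_rc; last exact: cover_set_meets h.
  by rewrite jf below_meets.
exists (rc l (F' |` Fs)%fset); first exact: fset1U1.
by rewrite rc_supp_rc; [rewrite il belowU negb_or iFs below1 nF|exact: cover_setU1].
Qed.

Lemma maxel1 (p : RC) : maxel [fset p]%fset = [fset p]%fset.
Proof.
apply/fsetP => q; apply/idP/idP => [/maxel_sub//|/fset1P ->].
by apply/maxelP; split=> [|n /fset1P//]; exact: fset11.
Qed.

Fact rc_covers_self p : rc_covers p [fset p]%fset.
Proof.
have [->|[l [Fs [h pE l0]]]] := rcP p; first by right.
left; exists l, Fs, [fset l]%fset; split=> //; first exact: covers_self.
have -> : [fset p]%fset = maxel [fset p]%fset by rewrite maxel1.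
apply: maxel_ext => [_ /fset1P ->|s].
  exists (rc l (meetsFF l Fs)).
    by apply/fset1UP; right; apply/imfsetP; exists l => //; rewrite inE.
  apply/rcleP => k; rewrite pE !rc_supp_rc//; last exact: cover_set_meets h.
  by move=> /andP[kl]; rewrite below_meets// kl.
move=> sS; exists p; first exact: fset11.
by rewrite pE; apply: rc_coverP sS => //; exact: covers_self.
Qed.

Lemma finite_cover_neq0 (p : RC) G : finite_cover p G -> p != \bot%O -> G != fset0.
Proof.
move=> [_ h] p0; apply: contra p0 => /eqP G0; apply/eqP; apply: (h p) => //.
by move=> f; rewrite G0.
Qed.

Fact rc_covers_restrict (p q : RC) G :
  rc_covers p G -> (q <= p)%O -> rc_covers q (meetsF q G).
Proof.
move=> pG qp; have [q0|q0] := eqVneq q \bot%O.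
  right; split => //; rewrite q0 -maxel1; apply: maxel_ext => s.
    move=> /bigfcupP[g _ /meets_lel]; rewrite lex0 => /eqP ->.
    by exists \bot%O => //; exact: fset11.
  move=> /fset1P ->; have [g gG] : exists g, g \in G.
    case: pG => [[l [Fs [F' [h lF _ ->]]]]|[_ ->]]; last first.
      by exists \bot%O; exact: fset11.
    have [g gG _] := maxel_above (fset1U1 (rc l (F' |` Fs)%fset)
      [fset rc f (meetsFF f Fs) | f in F']%fset).
    by exists g.
  have [m mg _] := meets_above (lexx \bot%O) (le0x g).
  exists m; last exact: le0x.
  by apply/bigfcupP; exists g; rewrite ?gG.
case: pG => [[l [Fs [F' [h lF pE ->]]]]|[p0 _]]; last first.
  by rewrite p0 lex0 (negPf q0) in qp.
have [k [Gs [hk qE qk qtop]]] := rc_top q0.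
have qp' (j : nz L) : rc_supp q j -> (val j <= l)%O && ~~ below (val j) Fs.
  by move/rcleP : qp => /[apply]; rewrite pE rc_supp_rc.
have kl : (val k <= l)%O by case/andP: (qp' _ qk).
have kF := covers_restrict lF kl.
have fk f : f \in meetsF (val k) F' -> (f <= val k)%O by case/meetsF_le.
left; exists (val k), Gs, (meetsF (val k) F'); split=> //.
rewrite /rc_cover; apply: maxel_ext => [m /bigfcupP[g /andP[/maxel_sub gS _] mqg]|s sS].
  have mq := meets_lel mqg; have mg := meets_ler mqg.
  have [m0|m0] := eqVneq m \bot%O.
    exists (rc (val k) (meetsF (val k) F' |` Gs)%fset); first exact: fset1U1.
    by rewrite m0 le0x.
  have [i [Hs [_ _ mi mtop]]] := rc_top m0.
  have qi : rc_supp q i by move/rcleP: mq; apply.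
  have gi : rc_supp g i by move/rcleP: mg; apply.
  have qs (j : nz L) : rc_supp m j -> (val j <= val k)%O && ~~ below (val j) Gs.
    by move/rcleP: mq => /[apply]; rewrite {1}qE rc_supp_rc.
  case/fset1UP: gS mg gi => [->|/imfsetP[f /= fF ->]] mg gi.
    exists (rc (val k) (meetsF (val k) F' |` Gs)%fset); first exact: fset1U1.
    apply/rcleP => j mj; rewrite rc_supp_rc; last exact: cover_setU1.
    have /andP[jk jG] := qs _ mj; rewrite jk belowU negb_or jG andbT below1 /=.
    move/rcleP: mg => /(_ _ mj); rewrite rc_supp_rc; last exact: cover_setU1.
    rewrite belowU negb_or below1 => /and3P[_ + _]; apply: contra.
    move=> /hasP[f' /meetsF_le[_ [f fF f'f]] jf'].
    by apply/hasP; exists f => //; apply: le_trans f'f.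
  have fl : (f <= l)%O by apply: (covers_cover lF).1.
  move: gi; rewrite rc_supp_rc => [/andP[jf _]|]; last exact: cover_set_meets h.
  have /andP[ik _] := qs _ mi.
  have [f' f'F if'] := meetsF_above fF ik jf.
  exists (rc f' (meetsFF f' Gs)).
    by apply/fset1UP; right; apply/imfsetP; exists f'.
  apply/rcleP => j mj; rewrite rc_supp_rc; last exact: cover_set_meets (fk _ f'F) hk.
  have jf' : (val j <= f')%O by apply: le_trans if'; apply: mtop.
  by rewrite jf' below_meets//; case/andP: (qs _ mj).
have sq : (s <= q)%O by rewrite qE; apply: rc_coverP sS.
suff [g gS sg] : exists2 g, g \in (rc l (F' |` Fs) |`
    [fset rc f (meetsFF f Fs) | f in F'])%fset & (s <= g)%O.
  have [g' g'G gg'] := maxel_above gS.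
  have [m mqg sm] := meets_above sq (le_trans sg gg').
  by exists m => //; apply/bigfcupP; exists g'; rewrite ?g'G.
have sp (j : nz L) : rc_supp s j -> (val j <= l)%O && ~~ below (val j) Fs.
  by move=> sj; apply: qp'; move/rcleP: sq; apply.
case/fset1UP: sS sq sp => [->|/imfsetP[f' /= f'F ->]] sq sp.
  exists (rc l (F' |` Fs)%fset); first exact: fset1U1.
  apply/rcleP => j sj; rewrite rc_supp_rc; last exact: cover_setU1.
  have /andP[-> jFs] := sp _ sj; rewrite belowU negb_or jFs andbT below1/=.
  move: sj; rewrite rc_supp_rc; last exact: cover_setU1.
  rewrite belowU negb_or below1 => /and3P[jk + _]; apply: contra.
  move=> /hasP[f fF jf]; have [f' f'F jf'] := meetsF_above fF jk jf.
  by apply/hasP; exists f'.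
have [f'k [f fF f'f]] := meetsF_le f'F.
have fl : (f <= l)%O by apply: (covers_cover lF).1.
exists (rc f (meetsFF f Fs)).
  by apply/fset1UP; right; apply/imfsetP; exists f.
apply/rcleP => j sj; rewrite rc_supp_rc; last exact: cover_set_meets h.
have /andP[_ jFs] := sp _ sj.
move: sj; rewrite rc_supp_rc => [/andP[jf' _]|]; last exact: cover_set_meets hk.
by rewrite (le_trans jf' f'f) below_meets// (le_trans jf' f'f).
Qed.

Definition rc_cover_system : cover_system RC :=
  CoverSystem rc_covers_cover rc_covers_self rc_covers_restrict.

End RelativeComplements.

Section Boundary.
Local Open Scope ring_scope.
Context d (L : lfWeakSemilatticeType d) (R : cover_system L).

(* The linear extension of the inclusion of [RC R] into [ZL L]; it is
   multiplicative by [bd_mul]. *)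
Definition bd (x : ZL (RC R)) : ZL L :=
  fglift (fun p : nz (RC R) => val (val p)) x.

Fact bd_additive : zmod_morphism bd.
Proof.
by move=> x y; apply: (@lift_is_additive int (nz (RC R)) (ZL L)
  (fun p => val (val p))).
Qed.

HB.instance Definition _ :=
  GRing.isZmodMorphism.Build (ZL (RC R)) (ZL L) bd bd_additive.

Lemma bd_emb (p : RC R) : bd (emb p) = val p.
Proof.
rewrite /emb; case: insubP => [u _ <-|]; first by rewrite /bd liftU scale1r.
by rewrite negbK => /eqP ->; rewrite raddf0.
Qed.

Lemma ev_bd x (k : nz L) : ev (bd x) k =
  \sum_(p <- dom x) coeff p x * (rc_supp (val p) k)%:R.
Proof.
have -> : bd x = \sum_(p <- dom x) coeff p x *: val (val p).
  by rewrite -[in LHS](freeg_sumE x) raddf_sum; apply: eq_bigr => p _; exact: liftU.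
rewrite ev_sum; apply: eq_bigr => p _.
by rewrite -[coeff p x in LHS]intz scaler_int evMz ev_rc -mulrzr mulrC intz.
Qed.

Lemma bd_mul (x y : ZL (RC R)) : bd (zmul x y) = zmul (bd x) (bd y).
Proof.
apply: ev_inj => k; rewrite ev_mul.
pose s := dom x ++ dom y ++ dom (zmul x y).
have [C [/fsubsetP sC Ccl]] := locally_finite [fset val p | p in s]%fset.
have inC z p : {subset dom z <= s} -> p \in dom z -> val p \in C.
  by move=> zs pz; apply: sC; apply/imfsetP; exists p => //=; apply: zs.
have xs : {subset dom x <= s} by move=> p px; rewrite mem_cat px.
have ys : {subset dom y <= s} by move=> p py; rewrite !mem_cat py orbT.
have xys : {subset dom (zmul x y) <= s} by move=> p pxy; rewrite !mem_cat pxy !orbT.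
have [[c [cC ck]]|nC] := pselect (exists c, c \in C /\ rc_supp c k); last first.
  have h z : {subset dom z <= s} -> ev (bd z) k = 0.
    move=> zs; rewrite ev_bd big_seq big1// => p pz.
    case: (boolP (rc_supp (val p) k)) => [pk|]; last by rewrite mulr0.
    by case: nC; exists (val p); split=> //; apply: inC pz.
  by rewrite !h// mulr0.
have [|c0 [c0C c0k c0min]] :=
  @closed_least _ (RC R) C (fun p => rc_supp p k) c Ccl _ cC ck.
  move=> a b _ _ ak bk; have [m [ma mb mk]] := rc_supp_common ak bk.
  have [n nab mn] := meets_above ma mb; exists n => //.
  by move/rcleP : mn; apply.
have c00 : c0 != \bot by apply: contraTneq c0k => ->; rewrite rc_supp0.
have h z : {subset dom z <= s} -> ev (bd z) k = ev z (Sub c0 c00 : nz (RC R)).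
  move=> zs; rewrite ev_bd evE; apply: eq_big_seq => p pz; congr (_ * _%:R).
  congr nat_of_bool; apply/idP/idP => [pk|/rcleP]; last exact.
  by apply: c0min => //; apply: inC pz.
by rewrite !h// ev_mul.
Qed.

End Boundary.

Section Subalgebra.
Local Open Scope ring_scope.
Context d (L : lfWeakSemilatticeType d).

Definition subalgebra (A : set (ZL L)) : Prop :=
  [/\ A 0, forall x y, A x -> A y -> A (x - y)
    & forall x y, A x -> A y -> A (zmul x y)].

Definition ideal (A : set (ZL L)) : Prop :=
  [/\ A 0, forall x y, A x -> A y -> A (x - y)
    & forall x y, A y -> A (zmul x y)].

Context (R : cover_system L).

Definition cover_complements : set (ZL L) := [set x | exists (l : L) F,
  R l F /\ x = emb l - zjoin [fset emb f | f in F]%fset].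

Definition I0 : set (ZL L) := smallest subalgebra cover_complements.

Definition in_I0 : {pred ZL L} := fun x => `[< I0 x >].

Fact I0_zmod_closed : zmod_closed in_I0.
Proof.
split=> [|x y]; first by apply/asboolP => A [[A0 _ _] _].
move=> /asboolP xI /asboolP yI; apply/asboolP => A /[dup] hA [[_ AB _] _].
by apply: AB; [apply: xI|apply: yI].
Qed.

HB.instance Definition _ := GRing.isZmodClosed.Build (ZL L) in_I0 I0_zmod_closed.

Definition quotient_map : ZL L -> {ideal_quot in_I0} := \pi_({ideal_quot in_I0})%qT.

End Subalgebra.

Record covered_semilattice d := CoveredSemilattice {
  semilattice :> lfWeakSemilatticeType d;
  system : cover_system semilattice
}.

Definition complements d (S : covered_semilattice d) : covered_semilattice d :=
  CoveredSemilattice (rc_cover_system (system S)).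

Definition tower d (S : covered_semilattice d) (i : nat) :
    covered_semilattice d :=
  iter i (@complements d) S.

(* [differential S i] is [d_{i+1}] *)
Definition differential d (S : covered_semilattice d) (i : nat) :
    ZL (tower S i.+1) -> ZL (tower S i) :=
  @bd d (tower S i) (system (tower S i)).
Arguments differential {d} S i _.

Definition exact_at (A B C : zmodType) (f : A -> B) (g : B -> C) : Prop :=
  range f = [set x | g x = 0%R].

(* Main.v *)
Require Import Defs.
From HB Require Import structures.
From mathcomp Require Import all_boot all_order all_algebra.
From mathcomp Require Import generic_quotient ring_quotient.
From mathcomp Require Import finmap.
From mathcomp Require Import boolp classical_sets cardinality.
From mathcomp Require Import freeg.
From mathcomp Require Import ring.

Set Implicit Arguments.
Unset Strict Implicit.
Unset Printing Implicit Defensive.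

Import Order.Theory GRing.Theory.

(** Write [p = (l | Fs)] for a relative complement, and recall that [ev] embeds
    [ZL] in the functions on the nonzero elements of [L], where [(l | Fs)] is
    the indicator of the elements below [l] but below no member of a cover
    in [Fs]; call [l] its top.

    The image of the differential [bd] is the subalgebra [I0]
    ([I0_range]), since [(l | F1, ..., Fn)] is the product of the generators
    [(l | Fi)].  It is an ideal ([I0_ideal]): multiplication by [m <= l] turns
    the generator of [F] into that of [meetsF m F], and the product of [k] with
    the generator of a cover of [l] is a join of such elements.

    The same two facts for the next level, whose ideal is called [I1], reduce
    exactness to [I1 = ker bd].  One inclusion ([bd_I1]) says that the covers
    of level one cover pointwise: every point of the indicator of [p] lies in
    some member of a cover of [p].

    For the other inclusion ([ker_bd]) let [bd x = 0] and let [J] be the ideal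
    of all [y] with [y x] in [I1].  If [J] contains the idempotents occurring in
    [x], then a local unit [w] for them gives [x = w x] in [I1].  Now
    [J] contains every [(l | Gs)] with [l] in a finite meet-closed set [C] that
    holds all data of [x], by induction on [l] ([I1_rc_mul]).  Modulo [I1],
    [(l | Gs)] is the join of [(l | F', Gs)] and of elements with tops [f] in
    [F'], so one can adjoin covers to [Gs] as long as their members are
    strictly below [l] ([emb_rc_refines]).  Adjoin to [Gs] the covers
    defining the terms [q] of [x] whose indicator contains [l].  Then
    [p = (l | Gs)] satisfies [p q = p] for these terms, and their
    contribution to [p x] is [p] times the value of [bd x] at [l], that is 0.
    For the other terms, [p q] is a join of elements with smaller tops, hence
    lies in [J], and a local unit [w] in [J] for these products gives
    [p x = p (w x)] in [I1]. *)

Local Open Scope classical_set_scope.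

(** * Subgroups, subalgebras and ideals of the free group *)

Section FreeGroup.
Local Open Scope ring_scope.
Context d (L : lfWeakSemilatticeType d).
Implicit Types (x y z : ZL L) (A : set (ZL L)).

Lemma emb_bot : emb (\bot%O : L) = 0.
Proof. by apply: ev_inj => k; rewrite ev_emb ev0 lex0 (negPf (valP k)). Qed.

Lemma zmul0 x : zmul x 0 = 0.
Proof. by apply: ev_inj => k; rewrite ev_mul !ev0 mulr0. Qed.

Lemma zmulBl x y z : zmul (x - y) z = zmul x z - zmul y z.
Proof. by apply: ev_inj => k; rewrite !(ev_mul, evB) mulrBl. Qed.

Lemma zmulBr x y z : zmul z (x - y) = zmul z x - zmul z y.
Proof. by rewrite -!(zmulC _ z) zmulBl. Qed.

Lemma zmul_sumr x (I : Type) (r : seq I) (P : pred I) (F : I -> ZL L) :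
  zmul x (\sum_(i <- r | P i) F i) = \sum_(i <- r | P i) zmul x (F i).
Proof.
apply: ev_inj => k; rewrite ev_mul !ev_sum mulr_sumr.
by apply: eq_bigr => i _; rewrite ev_mul.
Qed.

Lemma zmulMz x y (c : int) : zmul x (y *~ c) = zmul x y *~ c.
Proof. by apply: ev_inj => k; rewrite !(ev_mul, evMz) mulrzAr. Qed.

Lemma ZL_sumE x : x = \sum_(k <- dom x) emb (val k) *~ coeff k x.
Proof.
apply: ev_inj => k; rewrite evE ev_sum; apply: eq_bigr => l _.
by rewrite evMz ev_emb -mulrzr mulrC intz.
Qed.

Definition zmod_set A := A 0 /\ forall x y, A x -> A y -> A (x - y).

Lemma zmod_set_subalgebra A : subalgebra A -> zmod_set A.
Proof. by case. Qed.

Lemma zmod_setN A x : zmod_set A -> A x -> A (- x).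
Proof. by move=> [A0 AB] Ax; rewrite -sub0r; apply: AB. Qed.

Lemma zmod_setD A x y : zmod_set A -> A x -> A y -> A (x + y).
Proof.
by move=> hA Ax Ay; rewrite -(opprK y); apply: hA.2 => //; apply: zmod_setN.
Qed.

Lemma zmod_setMz A x (c : int) : zmod_set A -> A x -> A (x *~ c).
Proof.
move=> hA Ax; have hn n : A (x *+ n).
  by elim: n => [|n IH]; [exact: hA.1|rewrite mulrS; apply: zmod_setD].
case: c => n; first exact: hn.
by rewrite NegzE mulrNz; apply: zmod_setN => //; exact: hn.
Qed.

Lemma zmod_set_sum A (I : eqType) (r : seq I) (P : pred I) (F : I -> ZL L) :
  zmod_set A -> (forall i, i \in r -> P i -> A (F i)) ->
  A (\sum_(i <- r | P i) F i).
Proof.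
move=> hA AF; rewrite big_seq_cond; apply: (big_ind A).
- exact: hA.1.
- by move=> x y; apply: zmod_setD.
- by move=> i /andP[]; exact: AF.
Qed.

Lemma zmod_set_emb A : zmod_set A -> (forall l, A (emb l)) -> forall x, A x.
Proof.
move=> hA Al x; rewrite (ZL_sumE x); apply: zmod_set_sum => // k _ _.
exact: zmod_setMz.
Qed.

Lemma subalgebra_zjoin A (F : {fset ZL L}) :
  subalgebra A -> (forall p, p \in F -> A p) -> A (zjoin F).
Proof.
move=> /[dup] hA [A0 _ AM] AF; apply: zmod_set_sum => [|G _ _].
  exact: zmod_set_subalgebra.
apply: zmod_setMz; first exact: zmod_set_subalgebra.
case: (enum G) => [//|p s] /=.
have : A (fsval p) by apply: AF; exact: valP.
elim: s (fsval p) => [|q s IH] y Ay //=.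
apply: IH; apply: AM => //.
by apply: AF; exact: valP.
Qed.

Lemma ideal_subalgebra A : ideal A -> subalgebra A.
Proof. by case=> A0 AB AM; split=> // x y _; exact: AM. Qed.

Lemma zmod_set_ideal A : ideal A -> zmod_set A.
Proof. by case. Qed.

Lemma colon_ideal A x : ideal A -> ideal [set y | A (zmul y x)].
Proof.
move=> [A0 AB AM]; split=> [|y z Ay Az|y z Az] /=.
- by rewrite zmulC zmul0.
- by rewrite zmulBl; apply: AB.
- by rewrite -zmulA; apply: AM.
Qed.

(** Idempotents have joins [w + a - wa], which stay in the ideal.  The free
    group has in general no unit, and this is the substitute. *)
Lemma local_unit A (s : seq (ZL L)) : ideal A ->
  (forall y, y \in s -> A y /\ zmul y y = y) ->
  exists2 w, A w & forall y, y \in s -> zmul w y = y.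
Proof.
move=> /[dup] hA [A0 AB AM]; elim: s => [|a s IH] hs; first by exists 0.
have [y ys|w Aw wP] := IH; first by apply: hs; rewrite inE ys orbT.
have [Aa aa] := hs a (mem_head _ _).
exists (w + (a - zmul w a)) => [|y].
  apply: zmod_setD (zmod_set_ideal hA) Aw _.
  by apply: AB => //; apply: AM.
have E : zmul (w + (a - zmul w a)) y = zmul w y + (zmul a y - zmul a (zmul w y)).
  by apply: ev_inj => k; rewrite !(ev_mul, evB, evD); ring.
rewrite inE E => /predU1P[->|/wP ->]; last by rewrite subrr addr0.
by rewrite (zmulC a (zmul w a)) -zmulA aa addrC subrK.
Qed.

End FreeGroup.

(** * The image of the differential *)

Section Image.
Local Open Scope ring_scope.
Context d (L : lfWeakSemilatticeType d) (R : cover_system L).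
Implicit Types (x y z : ZL L) (A : set (ZL L)).

Lemma I0_subalgebra : subalgebra (I0 R).
Proof.
split=> [A [[]]//|x y Ix Iy A hA|x y Ix Iy A hA].
  by have [[_ AB _] _] := hA; apply: AB; [apply: Ix|apply: Iy].
by have [[_ _ AM] _] := hA; apply: AM; [apply: Ix|apply: Iy].
Qed.

Lemma I0_cover l F : R l F -> I0 R (emb l - zjoin [fset emb f | f in F]%fset).
Proof. by move=> lF A [_]; apply; exists l, F. Qed.

Lemma I0_ind A : subalgebra A ->
  (forall l F, R l F -> A (emb l - zjoin [fset emb f | f in F]%fset)) ->
  forall x, I0 R x -> A x.
Proof. by move=> hA AF x; apply; split=> // _ [l [F [lF ->]]]; apply: AF. Qed.

Lemma ev_cover l F k : R l F ->
  ev (emb l - zjoin [fset emb f | f in F]%fset) k =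
  ((val k <= l)%O && ~~ has (fun f => val k <= f)%O F)%:R.
Proof.
move=> /covers_cover[Fl _]; rewrite evB ev_emb ev_zjoin_emb.
case: hasP => [[f fF kf]|_]; last by rewrite subr0 andbT.
by rewrite (le_trans kf (Fl _ fF)) subrr.
Qed.

Lemma relcompl_cover (l : L) Fs F : cover_set R l Fs -> R l F ->
  relcompl l (F |` Fs)%fset =
  zmul (emb l - zjoin [fset emb f | f in F]%fset) (relcompl l Fs).
Proof.
move=> h lF; apply: ev_inj => k; rewrite ev_mul ev_cover// !ev_relcompl.
- rewrite belowU below1 negb_or -natrM mulnb.
  by case: (val k <= l)%O.
- exact: cover_set_le h.
- exact: cover_set_le (cover_setU1 h lF).
Qed.

Lemma relcompl1 (l : L) (F : {fset L}) :
  relcompl l [fset F]%fset = emb l - zjoin [fset emb f | f in F]%fset.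
Proof.
rewrite /relcompl; congr (_ - zjoin _); apply/fsetP => x.
apply/imfsetP/imfsetP => -[f /= fF ->]; exists f => //=.
  by move: fF => /bigfcupP[G /andP[/fset1P ->]].
by apply/bigfcupP; exists F; rewrite ?fset11.
Qed.

Lemma I0_relcompl l Fs : cover_set R l Fs -> I0 R (relcompl l Fs).
Proof.
have [_ _ IM] := I0_subalgebra.
elim/finSet_rect: Fs => Fs IH [/fset0Pn[F FF] Fsl].
have lF := Fsl _ FF.
have [E|/fset0Pn[G GF]] := eqVneq (Fs `\ F)%fset fset0.
  have -> : Fs = [fset F]%fset.
    by rewrite -(fsetD1K FF) E fsetU0.
  by rewrite relcompl1; exact: I0_cover.
have h : cover_set R l (Fs `\ F)%fset.
  split; first by apply/fset0Pn; exists G.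
  by move=> H /fsetD1P[_]; exact: Fsl.
rewrite -(fsetD1K FF) relcompl_cover//; apply: IM; first exact: I0_cover.
by apply: IH => //; exact: fproperD1.
Qed.

Lemma range_bd_subalgebra : subalgebra (range (@bd d L R)).
Proof.
split; first by exists 0 => //; rewrite raddf0.
  by move=> _ _ [x _ <-] [y _ <-]; exists (x - y) => //; rewrite raddfB.
by move=> _ _ [x _ <-] [y _ <-]; exists (zmul x y) => //; rewrite bd_mul.
Qed.

(** The range contains the generators and is a subalgebra because [bd] is
    multiplicative; conversely, a relative complement is a product of
    generators. *)
Lemma I0_range : I0 R = range (@bd d L R).
Proof.
apply/seteqP; split=> x.
  apply: I0_ind; first exact: range_bd_subalgebra.
  move=> l F lF; exists (emb (rc R l [fset F]%fset)) => //.
  rewrite bd_emb val_rc ?relcompl1//; split.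
    by apply/fset0Pn; exists F; rewrite inE.
  by move=> G /fset1P ->.
move=> [y _ <-]; move: y; apply: zmod_set_emb => [|p].
  split=> [|x' y]; first by rewrite raddf0; case: I0_subalgebra.
  by rewrite raddfB; case: I0_subalgebra => _ + _; apply.
rewrite bd_emb; have [->|[l [Fs [h -> _]]]] := rcP p.
  by case: I0_subalgebra.
by rewrite val_rc//; exact: I0_relcompl.
Qed.

Lemma cover_meets l F m : R l F -> (m <= l)%O ->
  zmul (emb m) (emb l - zjoin [fset emb f | f in F]%fset) =
  emb m - zjoin [fset emb f | f in meetsF m F]%fset.
Proof.
move=> lF ml; apply: ev_inj => k.
rewrite ev_mul ev_emb !ev_cover//; last exact: covers_restrict lF ml.
rewrite -natrM mulnb; case: (boolP (val k <= m)%O) => //= km.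
by rewrite (le_trans km ml) -!below1 -(below_meets _ km) /meetsFF imfset_fset1.
Qed.

(** For a generator [y] below [l], [k y = (k l) y] and [k l] is the join of
    [meets k l], whose elements [m] send [y] to another generator.  Joins are
    polynomials, so one needs that the [z] with [z y] in [I0] form a
    subalgebra; this holds as [y] is idempotent. *)
Lemma I0_ideal : ideal (I0 R).
Proof.
have [A0 AB AM] := I0_subalgebra.
split=> // v u Iu; move: v.
(* Products [z x y] stay in [I0] as [z x] and [y] do, so membership of [u] is
   carried along. *)
suff [] : I0 R u /\ forall x, I0 R (zmul x u) by [].
apply: (@I0_ind [set y | I0 R y /\ forall x, I0 R (zmul x y)]) Iu => /=.
  split=> /=; first by split=> // x; rewrite zmul0.
    move=> x y [xI xm] [yI ym]; split=> [|z]; first exact: AB.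
    by rewrite zmulBr; apply: AB.
  move=> x y [xI xm] [yI ym]; split=> [|z]; first exact: AM.
  by rewrite zmulA; apply: AM.
move=> l F lF; split; first exact: I0_cover.
set y := _ - _.
have yy : zmul y y = y.
  by apply: ev_inj => k; rewrite ev_mul ev_cover// -natrM mulnb andbb.
have ly : zmul (emb l) y = y.
  by apply: ev_inj => k; rewrite ev_mul ev_cover// ev_emb -natrM mulnb andbA andbb.
apply: zmod_set_emb => [|k].
  split; first by rewrite zmulC zmul0.
  by move=> x x' hx hx'; rewrite zmulBl; apply: AB.
rewrite -ly zmulA zmul_embE.
apply: (@subalgebra_zjoin _ L [set z | I0 R (zmul z y)]) => /=.
  split=> /= [|x x'|x x' hx hx']; first by rewrite zmulC zmul0.
    by rewrite zmulBl; apply: AB.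
  have -> : zmul (zmul x x') y = zmul (zmul x y) (zmul x' y); last exact: AM.
  rewrite -{1}yy; apply: ev_inj => j; rewrite !ev_mul; ring.
move=> _ /imfsetP[m /= mkl ->]; rewrite cover_meets ?(meets_ler mkl)//.
by apply: I0_cover; apply: covers_restrict lF (meets_ler mkl).
Qed.

End Image.

(** * The kernel of the differential *)

Section Exactness.
Local Open Scope ring_scope.
Context d (L : lfWeakSemilatticeType d) (R : cover_system L).
Local Notation I1 := (I0 (rc_cover_system R)).
Implicit Types (x y : ZL (RC R)) (l k : L) (Fs Gs : {fset {fset L}}).

Lemma rc_covers_supp (p : RC R) G (k : nz L) : rc_covers p G -> rc_supp p k ->
  exists2 g, g \in G & rc_supp g k.
Proof.
move=> [[l [Fs [F' [h lF -> ->]]]]|[-> _]]; last by rewrite rc_supp0.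
rewrite rc_supp_rc// => /andP[kl kFs].
suff [s sS sk] : exists2 s, s \in (rc R l (F' |` Fs) |`
    [fset rc R f (meetsFF f Fs) | f in F'])%fset & rc_supp s k.
  by have [g gG /rcleP sg] := maxel_above sS; exists g => //; apply: sg.
have [/hasP[f fF kf]|nF] := boolP (has (fun f => val k <= f)%O F').
  exists (rc R f (meetsFF f Fs)).
    by apply/fset1UP; right; apply/imfsetP; exists f.
  have fl : (f <= l)%O by apply: (covers_cover lF).1.
  rewrite rc_supp_rc; last exact: cover_set_meets h.
  by rewrite kf below_meets.
exists (rc R l (F' |` Fs)%fset); first exact: fset1U1.
by rewrite rc_supp_rc; [rewrite kl belowU negb_or kFs below1 nF|exact: cover_setU1].
Qed.

(** The generator [u] of a cover [G] of [p] satisfies [u p = u] and [u g = 0] for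
    [g] in [G].  So [bd u] vanishes outside the support of [p] and on the
    supports of the [g], and the latter cover the support of [p]. *)
Lemma bd_I1 x : I1 x -> bd x = 0.
Proof.
apply: (@I0_ind _ _ _ [set x | bd x = 0]) => [|p G pG] /=.
  split=> /= [|y z|y z _]; first exact: raddf0.
    by rewrite raddfB /= => -> ->; rewrite subr0.
  by rewrite bd_mul => ->; rewrite zmul0.
set u := _ - _.
have evu q := ev_cover (R := rc_cover_system R) q pG : ev u q = _.
have up : zmul u (emb p) = u.
  apply: ev_inj => q; rewrite ev_mul evu ev_emb -natrM mulnb.
  by case: (val q <= p)%O; rewrite ?andbT ?andbF.
have ug g : g \in G -> zmul u (emb g) = 0.
  move=> gG; apply: ev_inj => q; rewrite ev_mul evu ev_emb ev0 -natrM mulnb.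
  case: (boolP (val q <= g)%O) => qg; last by rewrite andbF.
  have -> : has (fun f => val q <= f)%O G by apply/hasP; exists g.
  by rewrite andbF.
apply: ev_inj => k; rewrite ev0 -up bd_mul ev_mul bd_emb ev_rc.
have [pk|] := boolP (rc_supp p k); last by rewrite mulr0.
have [g gG gk] := rc_covers_supp pG pk.
have := congr1 (fun z => ev (bd z) k) (ug _ gG).
by rewrite bd_mul ev_mul bd_emb ev_rc gk raddf0 ev0 mulr1.
Qed.

(** Modulo [I1], [(l | Fs)] is the join of the elements of its cover given by
    [F']. *)
Lemma emb_rc_refine (J : set (ZL (RC R))) l Fs F' :
  ideal J -> I1 `<=` J -> cover_set R l Fs -> R l F' ->
  J (emb (rc R l (F' |` Fs)%fset)) ->
  (forall f, f \in F' -> J (emb (rc R f (meetsFF f Fs)))) ->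
  J (emb (rc R l Fs)).
Proof.
move=> hJ IJ h lF JU Jf; set G := rc_cover R l Fs F'.
have lG : rc_covers (rc R l Fs) G by left; exists l, Fs, F'.
rewrite -(subrK (zjoin [fset emb g | g in G]%fset) (emb _)).
apply: zmod_setD; first exact: zmod_set_ideal.
  by apply: IJ; exact: (@I0_cover _ _ (rc_cover_system R) _ _ lG).
apply: subalgebra_zjoin; first exact: ideal_subalgebra.
move=> _ /imfsetP[g /= /maxel_sub/fset1UP[->|/imfsetP[f /= fF ->]] ->] //.
exact: Jf.
Qed.

(** All covers in [s] can be adjoined to [Fs], at the price of the elements whose
    tops are members of these covers. *)
Lemma emb_rc_refines (J : set (ZL (RC R))) l Fs (s : seq {fset L}) :
  ideal J -> I1 `<=` J -> cover_set R l Fs -> (forall F, F \in s -> R l F) ->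
  (forall F f Gs, F \in s -> f \in F -> cover_set R f Gs -> J (emb (rc R f Gs))) ->
  (forall Gs, cover_set R l Gs ->
     (forall F, (F \in s) || (F \in Fs) -> F \in Gs) -> J (emb (rc R l Gs))) ->
  J (emb (rc R l Fs)).
Proof.
move=> hJ IJ; elim: s Fs => [|F s IH] Fs h sl Jf JU; first exact: JU.
have lF : R l F by apply: sl; rewrite mem_head.
apply: (emb_rc_refine hJ IJ h lF) => [|f fF]; last first.
  apply: (Jf F) => //; first exact: mem_head.
  by apply: cover_set_meets h; apply: (covers_cover lF).1.
apply: IH => [|G Gs|G f Gs Gin|Gs hG sG].
- exact: cover_setU1.
- by apply: sl; rewrite inE Gs orbT.
- by apply: Jf; rewrite inE Gin orbT.
- by apply: JU => // G; rewrite inE -orbA => H; apply: sG; rewrite !inE orbCA.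
Qed.

(** This sum is the coefficient that [p] gets in [p x] from the terms of [x]
    that absorb [p], when [p] has top [k] and small enough support. *)
Lemma ev_bd_dom x (k : nz L) : ev (bd x) k =
  \sum_(q <- dom x | rc_supp (val q) k) coeff q x.
Proof.
rewrite ev_bd [RHS]big_mkcond /=; apply: eq_bigr => q _.
by case: rc_supp; rewrite ?mulr1 ?mulr0.
Qed.

(** The set [C] bounds the induction on [l]: the tops that arise from [l] are
    meets of [l] with tops and cover elements of the terms of [x], so they
    stay in [C].  The covers in [Gs] are arbitrary, as they never produce a
    top. *)
Lemma I1_rc_mul x (C : {fset L}) l Gs :
  meets_closed C -> bd x = 0 ->
  (forall q : nz (RC R), q \in dom x -> exists m Hs, [/\ cover_set R m Hs,
     val q = rc R m Hs, m \in C & forall H f, H \in Hs -> f \in H -> f \in C]) ->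
  l \in C -> cover_set R l Gs -> I1 (zmul (emb (rc R l Gs)) x).
Proof.
move=> Ccl x0 xC lC.
have I1i := I0_ideal (rc_cover_system R).
have [_ _ I1M] := I1i.
have [n] := ubnP #|` [fset c in C | c < l]%O%fset|.
elim: n => // n IHn in l lC Gs *; rewrite ltnS => ln.
pose J : set (ZL (RC R)) := [set y | I1 (zmul y x)].
have hJ : ideal J by exact: colon_ideal.
have IJ : I1 `<=` J by move=> y Iy; rewrite /J /= zmulC; apply: I1M.
have IH f Hs : f \in C -> (f < l)%O -> cover_set R f Hs -> J (emb (rc R f Hs)).
  move=> fC fl hf; apply: IHn => //; apply: leq_trans ln.
  apply: fproper_ltn_card; rewrite fproperE; apply/andP; split.
    by apply/fsubsetP => c; rewrite !inE /= => /andP[-> /lt_trans->].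
  apply/negP => /fsubsetP/(_ f); rewrite !inE /= fC fl ltxx.
  by move=> /(_ isT).
have [l0|l0] := eqVneq l \bot%O.
  move=> h; have -> : rc R l Gs = \bot%O.
    apply: rc_suppI => k.
    by rewrite rc_supp0 rc_supp_rc// l0 lex0 (negPf (valP k)).
  by rewrite emb_bot; case: hJ.
pose k : nz L := Sub l l0.
have /choice[r rP] (q : nz (RC R)) : exists mH : L * {fset {fset L}},
    q \in dom x -> [/\ cover_set R mH.1 mH.2, val q = rc R mH.1 mH.2,
       mH.1 \in C & forall H f, H \in mH.2 -> f \in H -> f \in C].
  have [/xC[m [Hs hq]]|nq] := boolP (q \in dom x); last by exists (l, Gs).
  by exists (m, Hs).
(* [D] collects the terms of [x] whose indicator contains [l]. *)
pose D := [seq q <- dom x | rc_supp (val q) k].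
have DP q : q \in D -> q \in dom x /\ (l <= (r q).1)%O && ~~ below l (r q).2.
  rewrite mem_filter => /andP[+ qx]; have [h -> _ _] := rP _ qx.
  by rewrite rc_supp_rc.
(* If [f = l] were a member of a cover in [s], then [l] would lie below a cover
   element of a term in [D] and not be in its indicator. *)
move=> hG; pose s := flatten [seq enum_fset (meetsFF l (r q).2) | q <- D].
have sP F : F \in s -> exists2 q, q \in D & exists2 H, H \in (r q).2 & F = meetsF l H.
  move=> /flatten_mapP[q qD /imfsetP[H /= HH ->]]; exists q => //; exists H => //.
apply: (@emb_rc_refines J l Gs s) => // [F|F f Hs|].
- move=> /sP[q /DP[qx /andP[lq _]] [H HH ->]].
  by apply: covers_restrict lq; have [[_ h] _ _ _] := rP _ qx; apply: h.
- move=> /sP[q /DP[qx /andP[lq nb]] [H HH ->]] /[dup] fF.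
  move=> /maxel_sub/bigfcupP[g /andP[gH _] flg].
  have [hq _ mC HC] := rP _ qx.
  apply: IH.
    by have /fsubsetP := Ccl _ _ lC (HC _ _ HH gH); apply.
  rewrite lt_neqAle (meets_lel flg) andbT; apply: contra nb => /eqP fl.
  apply/belowP; exists H, g; split=> //; rewrite -fl; exact: meets_ler flg.
move=> Gs' hG' sG; set p := rc R l Gs'.
have pD q : q \in D -> zmul (emb p) (emb (val q)) = emb p.
  move=> qD; have [qx /andP[lq _]] := DP _ qD.
  have [hq qE _ _] := rP _ qx.
  have /rcleP pq : forall j : nz L, rc_supp p j -> rc_supp (val q) j.
    move=> j; rewrite qE !rc_supp_rc// => /andP[jl nb].
    rewrite (le_trans jl lq) /=; apply: contra nb; rewrite -(below_meets (r q).2 jl).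
    move=> /belowP[F [f [FF fF jf]]]; apply/belowP; exists F, f; split=> //.
    apply: sG; apply/orP; left; apply/flatten_mapP; exists q => //.
  apply: ev_inj => j; rewrite ev_mul !ev_emb -natrM mulnb.
  by case: (boolP (_ <= p)%O) => //= jp; rewrite (le_trans jp pq).
have pE : zmul (emb p) x = \sum_(q <- dom x | ~~ rc_supp (val q) k)
    zmul (emb p) (emb (val q)) *~ coeff q x.
  rewrite {1}(ZL_sumE x) zmul_sumr (bigID (fun q => rc_supp (val q) k)) /=.
  rewrite [X in X + _](_ : _ = 0) ?add0r.
    by apply: eq_bigr => q _; rewrite zmulMz.
  rewrite big_seq_cond (eq_bigr (fun q => emb p *~ coeff q x)); last first.
    by move=> q /andP[qx qk]; rewrite zmulMz pD// mem_filter qk.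
  by rewrite -big_seq_cond -mulrz_sumr -ev_bd_dom x0 ev0.
(* If the top of [q] is above [l], then [l], and hence every point of [p], is
   below a cover element of [q], so that [p q = 0]; otherwise the common
   tops are strictly below [l]. *)
have pJ q : q \in dom x -> ~~ rc_supp (val q) k -> J (zmul (emb p) (emb (val q))).
  move=> qx; have [hq qE mC _] := rP _ qx; rewrite qE => nq.
  rewrite zmul_embE; apply: subalgebra_zjoin; first exact: ideal_subalgebra.
  move=> _ /imfsetP[g /= gpq ->].
  have [g0|g0] := eqVneq g \bot%O.
    by rewrite g0 emb_bot; case: hJ.
  have [j [_ [_ _ gj _]]] := rc_top g0.
  have /rcleP/(_ j gj) := meets_lel gpq; rewrite rc_supp_rc// => /andP[jl _].
  have /rcleP/(_ j gj) := meets_ler gpq; rewrite rc_supp_rc// => /andP[_ jq].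
  have {nq jl jq} lq : ~~ (l <= (r q).1)%O.
    apply: contra nq => lq; rewrite rc_supp_rc// lq /=; apply: contra jq.
    move=> /belowP[H [f [HH fH lf]]]; apply/belowP; exists H, f; split=> //.
    exact: le_trans lf.
  have [h1 h2] := rc_meetsP hG' hq.
  have /fsubsetP/(_ _ gpq)/imfsetP[n' /= n'l ->] := meets_sub h1 h2.
  apply: IH.
  - by have /fsubsetP := Ccl _ _ lC mC; apply.
  - rewrite lt_neqAle (meets_lel n'l) andbT; apply: contra lq => /eqP <-.
    exact: meets_ler n'l.
  - apply: cover_setU; first exact: cover_set_meets (meets_lel n'l) hG'.
    exact: cover_set_meets (meets_ler n'l) hq.
have [|w Jw wP] := @local_unit _ _ J
    [seq zmul (emb p) (emb (val q)) | q <- dom x & ~~ rc_supp (val q) k] hJ.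
  move=> y /mapP[q]; rewrite mem_filter => /andP[qk qx] ->; split; first exact: pJ.
  by apply: ev_inj => j; rewrite !ev_mul !ev_emb -!natrM !mulnb andbb.
have wp : zmul w (zmul (emb p) x) = zmul (emb p) x.
  rewrite pE zmul_sumr big_seq_cond [RHS]big_seq_cond; apply: eq_bigr.
  move=> q /andP[qx qk]; rewrite zmulMz wP//; apply/mapP; exists q => //.
  by rewrite mem_filter qk.
by rewrite /J /= -wp zmulA (zmulC w) -zmulA; apply: I1M; exact: Jw.
Qed.

Lemma ker_bd x : bd x = 0 -> I1 x.
Proof.
move=> x0.
have /choice[r rP] (q : nz (RC R)) : exists mH : L * {fset {fset L}},
    cover_set R mH.1 mH.2 /\ val q = rc R mH.1 mH.2.
  have [q0|[m [Hs [h qE _]]]] := rcP (val q); last by exists (m, Hs).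
  by have := valP q; rewrite q0 eqxx.
have [C [/fsubsetP sC Ccl]] := locally_finite (\bigcup_(q <- dom x)
  ((r q).1 |` \bigcup_(H <- (r q).2) H))%fset.
have qC q c : q \in dom x ->
    c \in ((r q).1 |` \bigcup_(H <- (r q).2) H)%fset -> c \in C.
  by move=> qx cq; apply: sC; apply/bigfcupP; exists q => //; rewrite qx.
have xC (q : nz (RC R)) : q \in dom x -> exists m Hs, [/\ cover_set R m Hs,
    val q = rc R m Hs, m \in C & forall H f, H \in Hs -> f \in H -> f \in C].
  move=> qx; have [h qE] := rP q; exists (r q).1, (r q).2; split=> //.
    by apply: (qC q) => //; exact: fset1U1.
  move=> H f HH fH; apply: (qC q) => //; apply/fset1UP; right.
  by apply/bigfcupP; exists H => //; rewrite HH.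
have hJ := colon_ideal x (I0_ideal (rc_cover_system R)).
have [|w Jw wP] := @local_unit _ _ _ [seq emb (val q) | q <- dom x] hJ.
  move=> y /mapP[q /xC[m [Hs [h qE mC _]]] ->]; split; last exact: zmul_emb.
  by rewrite qE; apply: I1_rc_mul xC _ _.
suff <- : zmul w x = x by [].
rewrite (ZL_sumE x) zmul_sumr; apply: eq_big_seq => q qx.
by rewrite zmulMz wP//; apply/mapP; exists q.
Qed.

Lemma exact_bd : range (@bd d (RC R) (rc_cover_system R)) =
  [set x | bd (R := R) x = 0].
Proof.
by rewrite -I0_range; apply/seteqP; split=> x; [exact: bd_I1|exact: ker_bd].
Qed.

End Exactness.

(** * The exact sequence *)

Lemma quotient_map0 d (L : lfWeakSemilatticeType d) (R : cover_system L) x :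
  (quotient_map R x = 0)%R <-> I0 R x.
Proof.
have -> : (0 = quotient_map R 0)%R by rewrite /quotient_map raddf0.
rewrite /quotient_map; split=> [/eqP|Ix].
  by rewrite eqquotE Quotient.equivE subr0 => /asboolP.
by apply/eqP; rewrite eqquotE Quotient.equivE subr0; apply/asboolP.
Qed.

Theorem theorem3p13 (d : Order.disp_t) (L0 : lfWeakSemilatticeType d)
    (R0 : cover_system L0) :
  let S := CoveredSemilattice R0 in
  [/\ I0 R0 = range (differential S 0),
      ideal (I0 R0),
      forall i : nat, exact_at (differential S i.+1) (differential S i),
      exact_at (differential S 0) (quotient_map R0)
    & range (quotient_map R0) = setT].
Proof.
move=> S; split.
- exact: I0_range.
- exact: I0_ideal.
- by move=> i; exact: exact_bd.
- rewrite /exact_at -[range _](I0_range R0).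
  by apply/seteqP; split=> x /quotient_map0.
- by apply/seteqP; split=> // q _; exists (repr q) => //; exact: reprK.
Qed.
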